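(* Let $G\subset U(V)$ be a finite complex reflection group and let $k=(k_{C,i})$ be an arbitrary tuple of complex parameters. Then the Dunkl operators on $P$ satisfy $$T_\xi(k)T_\eta(k)=T_\eta(k)T_\xi(k)\qquad\text{for all }\xi,\eta\in V.$$
   Context: $V$ is a finite dimensional complex Hilbert space. A complex reflection is an element $g\in U(V)$ of finite order such that $\operatorname{Ker}(g-\operatorname{Id})$ is a hyperplane; a finite complex reflection group is a finite subgroup $G\subset U(V)$ generated by complex reflections. For a hyperplane $H\subset V$, $G_H\subset G$ is the subgroup fixing $H$ pointwise (a cyclic group); $H$ is a reflection hyperplane if $G_H\neq\{\operatorname{Id}\}$, and then $e_H=|G_H|$. $\mathcal{A}$ is the set of reflection hyperplanes, $\mathcal{C}$ the set of $G$-orbits in $\mathcal{A}$; $e_H$ depends only on the orbit $C$ of $H$ and is also written $e_C$. $\chi_H$ is the restriction of $\det$ to $G_H$. For each $H\in\mathcal{A}$ choose $\alpha_H\in V^*$ with $\operatorname{Ker}\alpha_H=H$. $P$ is the ring of complex polynomial functions on $V$, with $G$-action $(gp)(x)=p^g(x)=p(g^{-1}x)$. Parameters: $k=(k_{C,i})$ with $k_{C,i}\in\mathbb{C}$, $C\in\mathcal{C}$, $1\le i\le e_C-1$; write $k_{H,i}=k_{C,i}$ if $H\in C$. Put $\epsilon_{H,i}=\frac1{e_H}\sum_{g\in G_H}\chi_H^i(g)\,g\in\mathbb{C}[G_H]$ and $a_H(k)=\sum_{i=1}^{e_H-1}e_Hk_{H,i}\epsilon_{H,i}$. For $p\in P$,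 $a_H(k)p$ is divisible by $\alpha_H$. For $\xi\in V$ the Dunkl operator on $P$ is $$T_\xi(k)=\partial_\xi+\sum_{H\in\mathcal{A}}\alpha_H(\xi)\,\alpha_H^{-1}a_H(k),$$ where $\partial_\xi$ is the directional derivative (it does not depend on the choice of the $\alpha_H$). *)

(* Defs.v *)
From HB Require Import structures.
From mathcomp Require Import all_boot all_order all_algebra.
From mathcomp Require Import finmap.
From mathcomp Require Import boolp classical_sets functions cardinality fsbigop.
From mathcomp Require Import reals topology normedtype derive.
From mathcomp Require Import complex.
From mathcomp Require mpoly.

Set Implicit Arguments.
Unset Strict Implicit.
Unset Printing Implicit Defensive.

Import Order.TTheory GRing.Theory Num.Theory.
Import numFieldNormedType.Exports.

Local Open Scope classical_set_scope.
Local Open Scope ring_scope.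

Section ComplexReflectionGroups.
Context {C : numClosedFieldType} {V : vectType C}.

Definition unitary (dot : {dot V for Num.conj}) (g : 'End(V)) : Prop :=
  isometry dot dot g.

Definition unitary_subgroup (dot : {dot V for Num.conj}) (S : set 'End(V)) :
    Prop :=
  [/\ forall g, S g -> unitary dot g,
      S \1%VF,
      forall g h, S g -> S h -> S (g \o h)%VF
    & forall g, S g -> S (g^-1)%VF].

Definition hyperplane (H : {vspace V}) : Prop := (\dim H).+1 = \dim {:V}.

(* [fixedSpace g] is the kernel of [g - \1]. *)
Definition complex_reflection (dot : {dot V for Num.conj}) (g : 'End(V)) :
    Prop :=
  [/\ unitary dot g,
      exists2 m, (0 < m)%N & forall v, iter m g v = v
    & hyperplane (fixedSpace g)].

Definition finite_complex_reflection_group (dot : {dot V for Num.conj})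
    (G : set 'End(V)) : Prop :=
  [/\ unitary_subgroup dot G,
      finite_set G
    & exists2 S : set 'End(V), S `<=` complex_reflection dot
                             & G = smallest (unitary_subgroup dot) S].

Definition pointwise_stab (G : set 'End(V)) (H : {vspace V}) : set 'End(V) :=
  [set g | G g /\ (H <= fixedSpace g)%VS].

Definition reflection_hyperplanes (G : set 'End(V)) : set {vspace V} :=
  [set H | hyperplane H /\ pointwise_stab G H <> [set \1%VF]].

Definition hyp_order (G : set 'End(V)) (H : {vspace V}) : nat :=
  #|` fset_set (pointwise_stab G H)|.

Definition hyp_orbit (G : set 'End(V)) (H : {vspace V}) : set {vspace V} :=
  [set (g @: H)%VS | g in G].

Definition lfun_det (g : 'End(V)) : C :=
  \det (passmx.mxof (vbasis {:V}) (vbasis {:V}) g).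

End ComplexReflectionGroups.

Section DunklOperators.
Context {C : numClosedFieldType} {V : vectType C}.

(* The functions on [V] that are polynomial in the coordinates with respect to
   some (equivalently, any) basis. *)
Definition polyfun (p : V -> C) : Prop :=
  exists q : mpoly.mpoly (\dim {:V}) C,
    forall v, p v = mpoly.meval (fun i => coord (vbasis {:V}) i v) q.

Definition gact (g : 'End(V)) (p : V -> C) : V -> C := fun x => p ((g^-1)%VF x).

Definition epsH (G : set 'End(V)) (H : {vspace V}) (i : nat) (p : V -> C) :
    V -> C :=
  fun x => (hyp_order G H)%:R^-1 *
    \sum_(g \in pointwise_stab G H) lfun_det g ^+ i * gact g p x.

(* A parameter tuple is a function of an orbit [O] and an index [i]; only its
   values at orbits of reflection hyperplanes and 1 <= i <= e_O - 1 matter. *)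
Definition aH (G : set 'End(V)) (k : set {vspace V} -> nat -> C)
    (H : {vspace V}) (p : V -> C) : V -> C :=
  fun x => \sum_(1 <= i < hyp_order G H)
    (hyp_order G H)%:R * k (hyp_orbit G H) i * epsH G H i p x.

(* The quotient f / a in the ring of polynomial functions (unique if a is a
   nonzero linear form; 0 by convention if a does not divide f). *)
Definition polyquo (f : V -> C) (a : 'Hom(V, C^o)) : V -> C :=
  xget (fun=> 0) [set q | polyfun q /\ forall x, f x = a x * q x].

Definition dirderive (xi : V) (p : V -> C) : V -> C :=
  fun x => 'D_1 (fun t : C^o => p (x + t *: xi) : C^o) 0.

Definition dunkl (G : set 'End(V)) (alpha : {vspace V} -> 'Hom(V, C^o))
    (k : set {vspace V} -> nat -> C) (xi : V) (p : V -> C) : V -> C :=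
  fun x => dirderive xi p x +
    \sum_(H \in reflection_hyperplanes G)
      alpha H xi * polyquo (aH G k H p) (alpha H) x.

End DunklOperators.

(* Main.v *)
(* Following Etingof and Ginzburg. By equivariance, g T_xi g^-1 = T_(g xi). The
   commutator of T_xi with multiplication by a linear form l is l(xi) plus
   sum_H alpha_H(xi) S_H, where S_H is a linear combination of the elements g
   of G_H; as g eta - eta = alpha_H(eta) (g u - u) when alpha_H(u) = 1, the
   commutator of S_H with T_eta is alpha_H(eta) times an operator independent
   of eta. Hence [[T_xi, l], T_eta] is symmetric in xi and eta, so by the
   Jacobi identity [T_xi, T_eta] commutes with l. It therefore commutes with
   multiplication by every polynomial, and it kills 1, so it is zero. *)

Require Import Defs.
From HB Require Import structures.
From mathcomp Require Import all_boot all_order all_algebra.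
From mathcomp Require Import boolp classical_sets functions cardinality fsbigop.
From mathcomp Require Import reals topology normedtype derive.
From mathcomp Require Import complex ring.
From mathcomp Require Import(canonicals) mpoly.

Set Implicit Arguments.
Unset Strict Implicit.
Unset Printing Implicit Defensive.

Import Order.TTheory GRing.Theory Num.Theory.
Import numFieldNormedType.Exports.

Local Open Scope classical_set_scope.
Local Open Scope ring_scope.

(** * Polynomial functions: closure properties and an induction principle *)

Section PolynomialFunctions.
Context {C : numClosedFieldType} {V : vectType C}.
Implicit Types (f g p q : V -> C) (l a : 'Hom(V, C^o)) (x xi eta u : V).

Lemma polyfun_cst (c : C) : polyfun ((fun=> c) : V -> C).
Proof. by exists (mpoly.mpolyC _ c) => v; rewrite mpoly.mevalC. Qed.

Lemma polyfunD f g : polyfun f -> polyfun g -> polyfun (fun x => f x + g x).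
Proof.
by move=> [P fP] [Q gQ]; exists (P + Q) => v; rewrite mpoly.mevalD fP gQ.
Qed.

Lemma polyfunM f g : polyfun f -> polyfun g -> polyfun (fun x => f x * g x).
Proof.
by move=> [P fP] [Q gQ]; exists (P * Q) => v; rewrite mpoly.mevalM fP gQ.
Qed.

Lemma eq_polyfun f g : f =1 g -> polyfun g -> polyfun f.
Proof. by move=> /funext ->. Qed.

Lemma polyfun_sum (I : Type) (r : seq I) (P : pred I) (F : I -> V -> C) :
  (forall i, P i -> polyfun (F i)) ->
  polyfun (fun x => \sum_(i <- r | P i) F i x).
Proof.
move=> polyF; elim: r => [|i r IHr].
  by apply: eq_polyfun (polyfun_cst 0) => x; rewrite big_nil.
have [Pi|NPi] := boolP (P i); last first.
  by apply: eq_polyfun IHr => x; rewrite big_cons (negbTE NPi).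
by apply: eq_polyfun (polyfunD (polyF i Pi) IHr) => x; rewrite big_cons Pi.
Qed.

Lemma polyfun_lfun l : polyfun l.
Proof.
have -> : (l : V -> C) = fun x => \sum_(i < \dim {:V})
    l (vbasis {:V})`_i * coord (vbasis {:V}) i x.
  apply/funext => x; rewrite {1}(coord_vbasis (memvf x)) linear_sum.
  by apply: eq_bigr => i _; rewrite linearZ mulrC.
apply: polyfun_sum => i _; apply: polyfunM; first exact: polyfun_cst.
by exists (mpoly.mpolyX _ (mpoly.mnm1 i)) => v; rewrite mpoly.mevalXU.
Qed.

(** Coordinates are linear forms, so constants and linear forms generate all polynomial functions
    under sums and products. Later arguments use this rule and never return to a basis or to
    monomials. *)
Lemma polyfun_ind (Q : (V -> C) -> Prop) :
  (forall c : C, Q (fun=> c)) -> (forall l, Q l) ->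
  (forall f g, polyfun f -> polyfun g -> Q f -> Q g ->
    Q (fun x => f x + g x)) ->
  (forall f g, polyfun f -> polyfun g -> Q f -> Q g ->
    Q (fun x => f x * g x)) ->
  forall p, polyfun p -> Q p.
Proof.
move=> Qcst Qlfun QD QM.
(* [QD] and [QM] apply to polynomial arguments only, so polynomiality is carried along with [Q]. *)
pose Q' f := polyfun f /\ Q f.
have Q'cst (c : C) : Q' (fun=> c) by split; [exact: polyfun_cst|exact: Qcst].
have Q'D f g : Q' f -> Q' g -> Q' (fun x => f x + g x).
  by move=> [pf Qf] [pg Qg]; split; [exact: polyfunD|exact: QD].
have Q'M f g : Q' f -> Q' g -> Q' (fun x => f x * g x).
  by move=> [pf Qf] [pg Qg]; split; [exact: polyfunM|exact: QM].
have Q'coord i : Q' (coord (vbasis {:V}) i).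
  have -> : (coord (vbasis {:V}) i : V -> C) =
      linfun (coord (vbasis {:V}) i : V -> C^o).
    by apply/funext => x; rewrite lfunE.
  by split; [exact: polyfun_lfun|exact: Qlfun].
move=> p [P pP]; suff : Q' p by case.
rewrite (funext pP) {p pP}.
have Q'eq f g : f =1 g -> Q' g -> Q' f by move=> /funext ->.
elim/mpoly.mpolyind: P => [|c m P _ _ IHP].
  by apply: Q'eq (Q'cst 0) => v; rewrite mpoly.meval0.
suff Q'm : Q' (fun v => mpoly.meval (fun i => coord (vbasis {:V}) i v)
    (mpoly.mpolyX C m)).
  apply: Q'eq (Q'D _ _ (Q'M _ _ (Q'cst c) Q'm) IHP) => v.
  by rewrite mpoly.mevalD mpoly.mevalZ.
apply: (@Q'eq _ (fun v =>
    \prod_i coord (vbasis {:V}) i v ^+ mpoly.fun_of_multinom m i)).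
  by move=> v; rewrite mpoly.mevalX.
elim: (index_enum _) => [|i r IHr].
  by apply: Q'eq (Q'cst 1) => v; rewrite big_nil.
suff Q'i n : Q' (fun v => coord (vbasis {:V}) i v ^+ n).
  by apply: Q'eq (Q'M _ _ (Q'i _) IHr) => v; rewrite big_cons.
elim: n => [|n IHn].
  by apply: Q'eq (Q'cst 1) => v; rewrite expr0.
by apply: Q'eq (Q'M _ _ (Q'coord i) IHn) => v; rewrite exprS.
Qed.

Lemma polyfun_comp (h : 'End(V)) p : polyfun p -> polyfun (fun x => p (h x)).
Proof.
elim/polyfun_ind: p / => [c|l|f g _ _|f g _ _].
- exact: polyfun_cst.
- have -> : (fun x => l (h x) : C) = (l \o h)%VF.
    by apply/funext => x; rewrite comp_lfunE.
  exact: polyfun_lfun.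
- exact: polyfunD.
- exact: polyfunM.
Qed.

(** * Directional derivatives of polynomial functions *)

Lemma polyfun_derivable x xi p : polyfun p ->
  derivable (fun t : C^o => p (x + t *: xi) : C^o) 0 1.
Proof.
elim/polyfun_ind: p / => [c|l|f g _ _|f g _ _].
- exact: derivable_cst.
- under eq_fun do rewrite linearD linearZ.
  apply: derivableD; first exact: derivable_cst.
  by apply: derivableM; [exact: derivable_id|exact: derivable_cst].
- exact: derivableD.
- exact: derivableM.
Qed.

Lemma dirderive_cst xi (c : C) : dirderive xi ((fun=> c) : V -> C) = fun=> 0.
Proof. by apply/funext => x; exact: derive_cst. Qed.

Lemma dirderive_lfun xi l : dirderive xi l = fun=> l xi.
Proof.
apply/funext => x; rewrite /dirderive.
have -> : (fun t : C^o => l (x + t *: xi) : C^o) =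
    cst (l x : C^o) + id * cst (l xi : C^o).
  by apply/funext => t; rewrite linearD linearZ.
have did : derivable (id : C^o -> C^o) 0 1 by exact: derivable_id.
have dcst (c : C^o) : derivable (cst c : C^o -> C^o) 0 1.
  by exact: derivable_cst.
have dM : derivable (id * cst (l xi) : C^o -> C^o) 0 1.
  exact: (@derivableM C C^o _ _ _ _ did (dcst (l xi))).
rewrite (deriveD (dcst (l x)) dM) (@deriveM C C^o _ _ _ _ did (dcst (l xi))).
rewrite !derive_cst derive_id scaler0 !add0r.
exact: mulr1.
Qed.

Lemma dirderiveD xi f g : polyfun f -> polyfun g ->
  dirderive xi (fun x => f x + g x) =
  fun x => dirderive xi f x + dirderive xi g x.
Proof.
move=> pf pg; apply/funext => x.
by apply: deriveD; exact: polyfun_derivable.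
Qed.

Lemma dirderiveM xi f g : polyfun f -> polyfun g ->
  dirderive xi (fun x => f x * g x) =
  fun x => f x * dirderive xi g x + g x * dirderive xi f x.
Proof.
move=> pf pg; apply/funext => x; rewrite /dirderive.
rewrite [LHS](deriveM (polyfun_derivable pf) (polyfun_derivable pg)).
by rewrite scale0r addr0.
Qed.

Lemma dirderiveZ xi (c : C) f : polyfun f ->
  dirderive xi (fun x => c * f x) = fun x => c * dirderive xi f x.
Proof.
move=> pf; rewrite dirderiveM//; last exact: polyfun_cst.
by apply/funext => x; rewrite dirderive_cst mulr0 addr0.
Qed.

Lemma polyfun_dirderive xi p : polyfun p -> polyfun (dirderive xi p).
Proof.
elim/polyfun_ind: p / => [c|l|f g pf pg df dg|f g pf pg df dg].
- by rewrite dirderive_cst; exact: polyfun_cst.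
- by rewrite dirderive_lfun; exact: polyfun_cst.
- by rewrite dirderiveD//; exact: polyfunD.
- by rewrite dirderiveM//; apply: polyfunD; exact: polyfunM.
Qed.

(** Directional derivatives of a general function need not be additive in the direction; for
    polynomials this is inherited from linear forms through the Leibniz rule. *)
Lemma dirderive_dirP (c : C) xi eta p : polyfun p ->
  dirderive (xi + c *: eta) p =
  fun x => dirderive xi p x + c * dirderive eta p x.
Proof.
elim/polyfun_ind: p / => [d|l|f g pf pg df dg|f g pf pg df dg]; apply/funext => x.
- by rewrite !dirderive_cst mulr0 addr0.
- by rewrite !dirderive_lfun linearD linearZ.
- by rewrite !dirderiveD// df dg; ring.
- by rewrite !dirderiveM// df dg; ring.
Qed.

(** * Division of polynomial functions by a linear form *)

Lemma lfun_preim1 a : a != 0 -> exists u, a u = 1.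
Proof.
move=> a0; have [u au0] : exists u, a u != 0.
  have [//|au0] := pselect (exists u, a u != 0).
  exfalso; move/eqP: a0; apply; apply/lfunP => x; rewrite zero_lfunE.
  by apply/eqP/negPn/negP => axN0; apply: au0; exists x.
exists ((a u)^-1 *: u); rewrite linearZ; exact: mulVf.
Qed.

(* Telescoping p x - p (x - a x u) with a u = 1 reduces divisibility by a to
   the case of constants and linear forms. *)
Lemma polyfun_dvd a p : polyfun p -> a != 0 ->
  (forall x, a x = 0 -> p x = 0) ->
  exists2 q, polyfun q & forall x, p x = a x * q x.
Proof.
move=> pp /lfun_preim1[u au] p0.
have hlin : linear (fun x => x - (a x : C) *: u).
  move=> c x y; rewrite linearP/= scalerDl scalerBr opprD addrACA.
  by rewrite -(scalerA c (a x)).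
pose hL : {linear V -> V} := HB.pack (fun x => x - (a x : C) *: u)
  (GRing.isLinear.Build _ _ _ _ _ hlin).
pose h : 'End(V) := linfun hL.
have hE x : h x = x - a x *: u.
  by rewrite lfunE.
suff [q pq qE] : exists2 q, polyfun q & forall x, p x - p (h x) = a x * q x.
  exists q => // x; rewrite -qE (p0 (h x)) ?subr0// hE linearB linearZ/= au.
  by rewrite [_ *: _]mulr1 subrr.
elim/polyfun_ind: p / pp {p0} => [c|l|
  f g pf pg [q pq qE] [r pr rE]|f g pf pg [q pq qE] [r pr rE]].
- by exists (fun=> 0); [exact: polyfun_cst|move=> x; rewrite subrr mulr0].
- exists (fun=> l u); first exact: polyfun_cst.
  by move=> x; rewrite hE linearB linearZ/= opprB addrC subrK.
- exists (fun x => q x + r x); first exact: polyfunD.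
  by move=> x; rewrite mulrDr -qE -rE; ring.
(* From [f x * g x - f (h x) * g (h x) = (f x - f (h x)) * g x + f (h x) * (g x - g (h x))]. *)
- exists (fun x => q x * g x + f (h x) * r x).
    by apply: polyfunD; apply: polyfunM => //; exact: polyfun_comp.
  by move=> x; rewrite mulrDr mulrA -qE mulrCA -rE; ring.
Qed.

(* Off the kernel of a this is cancellation; on it, differentiate a * p. *)
Lemma polyfun_mulI a p : polyfun p -> a != 0 ->
  (forall x, a x * p x = 0) -> forall x, p x = 0.
Proof.
move=> pp /lfun_preim1[u au] ap0 x.
have [ax0|ax0] := eqVneq (a x : C) 0; last first.
  by have /eqP := ap0 x; rewrite mulf_eq0 (negbTE ax0) => /eqP.
have := congr1 (fun f => dirderive u f x) (funext ap0).
rewrite dirderiveM//; last exact: polyfun_lfun.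
by rewrite dirderive_cst dirderive_lfun au ax0 mul0r add0r mulr1.
Qed.

(** Cancellation makes the quotient unique, so the choice made in [polyquo] is harmless: a quotient
    is computed by exhibiting a polynomial with the right product. *)
Lemma polyquo_eq a p q : polyfun q -> a != 0 ->
  (forall x, p x = a x * q x) -> polyquo p a = q.
Proof.
move=> pq a0 pE; rewrite /polyquo; case: xgetP => [r _ [pr rE]|/(_ q)]; last first.
  by case; split.
apply/funext => x; apply/eqP; rewrite -subr_eq0; apply/eqP.
move: x; apply: (@polyfun_mulI a) => // [|x].
  under eq_fun do rewrite -mulN1r.
  by apply: polyfunD => //; apply: polyfunM => //; exact: polyfun_cst.
by rewrite mulrBr -rE -pE subrr.
Qed.

Lemma polyquoP a p : polyfun p -> a != 0 -> (forall x, a x = 0 -> p x = 0) ->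
  polyfun (polyquo p a) /\ forall x, p x = a x * polyquo p a x.
Proof.
by move=> pp a0 /(polyfun_dvd pp a0)[q pq pE]; rewrite (polyquo_eq pq a0 pE).
Qed.

(** Linearity extends the commutation from linear forms to multiplication by every polynomial [q];
    then [D q = q * D 1 = 0]. *)
Lemma polyfun_mul_commuting_eq0 (D : (V -> C) -> V -> C) :
  (forall f g x, polyfun f -> polyfun g ->
    D (fun y => f y + g y) x = D f x + D g x) ->
  (forall c f x, polyfun f -> D (fun y => c * f y) x = c * D f x) ->
  (forall l f x, polyfun f -> D (fun y => l y * f y) x = l x * D f x) ->
  (forall x, D (fun=> 1) x = 0) ->
  forall p, polyfun p -> forall x, D p x = 0.
Proof.
move=> DD DZ Dl D1 p pp x.
suff DM q : polyfun q -> forall f, polyfun f ->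
    forall x, D (fun y => q y * f y) x = q x * D f x.
  have := DM p pp _ (polyfun_cst 1) x; rewrite D1 mulr0 => <-.
  by congr (D _ x); apply/funext => y; rewrite mulr1.
elim/polyfun_ind: q / => [c|l|q r pq pr Dq Dr|q r pq pr Dq Dr] f pf z.
- exact: DZ.
- exact: Dl.
- have -> : (fun y => (q y + r y) * f y) = fun y => q y * f y + r y * f y.
    by apply/funext => y; rewrite mulrDl.
  by rewrite DD ?Dq ?Dr ?mulrDl//; exact: polyfunM.
- have -> : (fun y => q y * r y * f y) = fun y => q y * (r y * f y).
    by apply/funext => y; rewrite mulrA.
  by rewrite Dq ?Dr ?mulrA//; exact: polyfunM.
Qed.

End PolynomialFunctions.

(** * Determinants of endomorphisms *)

Section UnitaryGroups.
Context {C : numClosedFieldType} {V : vectType C}.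
Implicit Types (g h : 'End(V)) (H : {vspace V}) (a : 'Hom(V, C^o)) (x u v : V).

Lemma lfun_detM g h : lfun_det (g \o h) = lfun_det g * lfun_det h.
Proof.
rewrite /lfun_det (@passmx.mxof_comp _ _ _ _ _ (vbasis {:V})) ?vbasisP//.
by rewrite det_mulmx mulrC.
Qed.

Lemma lfun_det1 : lfun_det (\1%VF : 'End(V)) = 1.
Proof. by rewrite /lfun_det passmx.mxof1 ?det1// (basis_free (vbasisP _)). Qed.

Lemma lfun_det_conj g h : lker g == 0%VS ->
  lfun_det (g \o h \o g^-1) = lfun_det h.
Proof.
move=> g0; rewrite !lfun_detM mulrAC -lfun_detM lker0_compfV//.
by rewrite lfun_det1 mul1r.
Qed.

(** Both products in [E] equal the block matrix with rows [(1, - r)] and [(c, 1)]; the determinants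
    of the triangular factors give the two sides. *)
Lemma det_1D_mul n (c : 'cV[C]_n) (r : 'rV[C]_n) :
  \det (1%:M + c *m r) = 1 + (r *m c) 0 0.
Proof.
have E : block_mx 1%:M 0 c 1%:M *m block_mx 1%:M (- r) 0 (1%:M + c *m r) =
  block_mx (1%:M + r *m c) (- r) 0 1%:M *m block_mx (1%:M : 'M[C]_1) 0 c 1%:M.
  rewrite !mulmx_block !mul1mx !mulmx1 !mul0mx !mulmx0 ?addr0 ?add0r.
  by rewrite mulmxN mulNmx addrK addrCA addNr addr0.
move/(congr1 determinant): E; rewrite !det_mulmx !(det_lblock, det_ublock).
by rewrite !det1 !mul1r !mulr1 => ->; rewrite det_mx11 !mxE.
Qed.

(** In the row-vector convention of [passmx], the matrix of [g] is the identity plus the column of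
    values of [a] times the row of coordinates of [v]. Nothing is assumed on [a v], so reflections
    are covered as well as transvections. *)
Lemma lfun_det_transvection g a v :
  (forall x, g x = x + (a x : C) *: v) -> lfun_det g = 1 + a v.
Proof.
move=> gE; rewrite /lfun_det.
have bV := vbasisP {:V}.
pose c : 'cV[C]_(\dim {:V}) := \col_i a (vbasis {:V})`_i.
have cE w : w *m c = (a (passmx.vecof (vbasis {:V}) w))%:M.
  apply/matrixP => i j; rewrite !ord1 !mxE eqxx mulr1n /passmx.vecof linear_sum.
  by apply: eq_bigr => k _; rewrite linearZ mxE.
have -> : passmx.mxof (vbasis {:V}) (vbasis {:V}) g =
    1%:M + c *m passmx.rVof (vbasis {:V}) v.
  apply/row_matrixP => i; rewrite !rowE passmx.mul_mxof gE addrC.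
  rewrite passmx.rVof_linear passmx.vecofK// addrC mulmxDr mulmx1 mulmxA cE.
  by rewrite mul_scalar_mx.
by rewrite det_1D_mul cE passmx.rVofK// mxE eqxx mulr1n.
Qed.

(** * Pointwise stabilizers of hyperplanes in a finite unitary group *)

Section Stabilizer.
Context (dot : {dot V for Num.conj}) (G : set 'End(V)).
Context (hG : unitary_subgroup dot G) (finG : finite_set G).

(** Isometries are injective because the form is definite. The cancellation laws for [g^-1] used
    below rest on this. *)
Lemma unitary_subgroup_lker0 g : G g -> lker g == 0%VS.
Proof.
case: hG => Gu _ _ _ /Gu gu; apply/lker0P => x y gxy.
apply/eqP; rewrite -subr_eq0 -(dnorm_eq0 dot).
by rewrite -gu linearB/= gxy subrr linear0l.
Qed.

(** The vector [x - a x *: u] lies in [H], hence is fixed by [g]. *)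
Lemma pointwise_stabE H a u g : lker a = H -> a u = 1 -> pointwise_stab G H g ->
  forall x, g x = x + (a x : C) *: (g u - u).
Proof.
move=> aH au [_ /subvP gH] x.
have : x - (a x : C) *: u \in fixedSpace g.
  apply: gH; rewrite -aH memv_ker linearB linearZ/= au.
  by apply/eqP; rewrite [_ *: _]mulr1 subrr.
move/fixedSpaceP; rewrite linearB linearZ/= => /eqP.
by rewrite subr_eq => /eqP ->; rewrite scalerBr addrAC addrA.
Qed.

Lemma pointwise_stab_det H a u g : lker a = H -> a u = 1 ->
  pointwise_stab G H g -> lfun_det g = a (g u).
Proof.
move=> aH au gH; rewrite (lfun_det_transvection (pointwise_stabE aH au gH)).
by rewrite linearB/= au addrC subrK.
Qed.

(** A unitary transvection is trivial: determinant 1 puts [v = g u - u] in [H], so [g v = v], and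
    the squared norm of [v] is the product of [g u] with [g v] minus that of [u] with [v], which is
    zero by unitarity. *)
Lemma pointwise_stab_det1 H a g : lker a = H -> a != 0 ->
  pointwise_stab G H g -> lfun_det g = 1 -> g = \1%VF.
Proof.
move=> aH a0 gH; have [u au] := lfun_preim1 a0.
rewrite (pointwise_stab_det aH au gH) => agu.
pose v := g u - u.
have gv : g v = v.
  rewrite (pointwise_stabE aH au gH v) [a v]linearB/= agu au subrr.
  by rewrite scale0r addr0.
have [Gu _ _ _] := hG; case: (gH) => /Gu gu _.
have v0 : v = 0.
  by apply/eqP; rewrite -(dnorm_eq0 dot) {1}/v linearBl/= -{1}gv gu subrr.
apply/lfunP => x; rewrite (pointwise_stabE aH au gH x) -/v v0 scaler0 addr0.
by rewrite id_lfunE.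
Qed.

Lemma pointwise_stab1 H : pointwise_stab G H \1%VF.
Proof.
have [_ G1 _ _] := hG; split=> //; apply/subvP => x _.
by apply/fixedSpaceP; rewrite id_lfunE.
Qed.

Lemma pointwise_stabM H g h : pointwise_stab G H g -> pointwise_stab G H h ->
  pointwise_stab G H (g \o h)%VF.
Proof.
have [_ _ GM _] := hG; move=> [Gg /subvP gH] [Gh /subvP hH].
split; first exact: GM.
apply/subvP => x xH; apply/fixedSpaceP; rewrite comp_lfunE.
by rewrite (fixedSpaceP (hH _ xH)) (fixedSpaceP (gH _ xH)).
Qed.

Lemma pointwise_stabV H g :
  pointwise_stab G H g -> pointwise_stab G H (g^-1)%VF.
Proof.
have [_ _ _ GV] := hG; move=> [Gg /subvP gH]; split; first exact: GV.
apply/subvP => x xH; apply/fixedSpaceP.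
rewrite -{1}(fixedSpaceP (gH _ xH)) lker0_lfunK//.
exact: unitary_subgroup_lker0.
Qed.

Lemma pointwise_stab_finite H : finite_set (pointwise_stab G H).
Proof. by apply: sub_finite_set finG => g []. Qed.

Lemma pointwise_stab_det_inj H a : lker a = H -> a != 0 ->
  {in pointwise_stab G H &, injective lfun_det}.
Proof.
move=> aH a0 g h /set_mem gH /set_mem hH dgh.
have h0 : lker h == 0%VS by apply: unitary_subgroup_lker0; case: hH.
have : (h^-1 \o g)%VF = \1%VF.
  apply: (pointwise_stab_det1 aH a0).
    exact: pointwise_stabM (pointwise_stabV hH) gH.
  by rewrite lfun_detM dgh -lfun_detM lker0_compVf// lfun_det1.
by move=> /(congr1 (fun f => h \o f)%VF); rewrite lker0_compVKf// comp_lfun1r.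
Qed.

Lemma pointwise_stab_mull_bij H g : pointwise_stab G H g ->
  set_bij (pointwise_stab G H) (pointwise_stab G H) (fun h => g \o h)%VF.
Proof.
move=> gH; have g0 : lker g == 0%VS by apply: unitary_subgroup_lker0; case: gH.
split=> [h hH|h h' _ _ ghh'|h hH]; first exact: pointwise_stabM.
  by rewrite -(lker0_compKf g0 h) ghh' lker0_compKf.
exists (g^-1 \o h)%VF; last by rewrite lker0_compVKf.
exact: pointwise_stabM (pointwise_stabV gH) hH.
Qed.

(* [lfun_det] is injective on the stabilizer, and X^i - 1 has at most i < e_H
   roots, so [lfun_det ^+ i] is a nontrivial character. *)
Lemma pointwise_stab_det_sum H a i : lker a = H -> a != 0 ->
  (0 < i < hyp_order G H)%N ->
  \sum_(g \in pointwise_stab G H) lfun_det g ^+ i = 0.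
Proof.
move=> aH a0 /andP[i0 ie].
have [g gH dg] : exists2 g, pointwise_stab G H g & lfun_det g ^+ i != 1.
  have [//|all1] :=
    pselect (exists2 g, pointwise_stab G H g & lfun_det g ^+ i != 1).
  exfalso; move: ie; rewrite ltnNge => /negP; apply.
  rewrite /hyp_order -(size_map lfun_det); apply: max_unity_roots => //.
    apply/allP => _ /mapP[g + ->].
    rewrite in_fset_set ?inE; last exact: pointwise_stab_finite.
    move=> gH; rewrite unity_rootE; apply/negPn/negP => dg.
    by apply: all1; exists g.
  rewrite map_inj_in_uniq ?finmap.fset_uniq// => g h.
  rewrite !in_fset_set; try exact: pointwise_stab_finite.
  exact: (pointwise_stab_det_inj aH a0).
(* Translating the summation index by [g] multiplies [S] by [lfun_det g ^+ i], which is not 1. *)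
set S := \sum_(_ \in _) _.
have : S = lfun_det g ^+ i * S.
  rewrite {1}/S (reindex_fsbig _ _ _ _ (pointwise_stab_mull_bij gH)).
  rewrite [in RHS]/S !fsbig_finite; try exact: pointwise_stab_finite.
  by rewrite big_distrr/=; apply: eq_bigr => h _; rewrite lfun_detM exprMn.
move=> /eqP; rewrite -subr_eq0 -{1}(mul1r S) -mulrBl mulf_eq0 subr_eq0 eq_sym.
by rewrite (negbTE dg) => /eqP.
Qed.

Lemma hyperplane_fixedSpace H g : hyperplane H -> pointwise_stab G H g ->
  g <> \1%VF -> fixedSpace g = H.
Proof.
move=> hH [_ gH] g1; apply/esym/eqP; rewrite eqEdim gH/= leqNgt.
apply/negP => dimH; apply: g1; apply/lfunP => x; rewrite id_lfunE.
apply/fixedSpaceP; suff -> : fixedSpace g = {:V}%VS by exact: memvf.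
by apply/eqP; rewrite eqEdim subvf/= -hH.
Qed.

(** Each reflection hyperplane is the fixed space of some element of the finite set [G]. This turns
    the sum in [dunkl] into an ordinary finite sum. *)
Lemma reflection_hyperplanes_finite : finite_set (reflection_hyperplanes G).
Proof.
apply: sub_finite_set (finite_image (@fixedSpace _ V) finG) => H [hH stabH].
have [[g gH g1]|all1] :=
    pselect (exists2 g, pointwise_stab G H g & g <> \1%VF).
  by exists g; [case: gH|exact: hyperplane_fixedSpace g1].
exfalso; apply: stabH; apply/seteqP; split=> [g gH|_ ->]; last first.
  exact: pointwise_stab1.
by apply: contrapT => g1; apply: all1; exists g.
Qed.

(** * The action of the group on hyperplanes and, by conjugation, on stabilizers *)

Lemma limgK g : lker g == 0%VS ->
  cancel (fun H => g @: H)%VS (fun H => g^-1 @: H)%VS.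
Proof. by move=> g0 H; rewrite -limg_comp lker0_compVf// lim1g. Qed.

Lemma limgVK g : lker g == 0%VS ->
  cancel (fun H => g^-1 @: H)%VS (fun H => g @: H)%VS.
Proof. by move=> g0 H; rewrite -limg_comp lker0_compfV// lim1g. Qed.

Lemma lker_inv g : lker g == 0%VS -> lker (g^-1)%VF == 0%VS.
Proof. by move=> g0; apply/lker0P; exact: can_inj (lker0_lfunVK g0). Qed.

Lemma lfun_invK g : lker g == 0%VS -> (g^-1^-1)%VF = g.
Proof.
move=> g0; apply/lfunP => x; rewrite -{1}(lker0_lfunK g0 x).
by rewrite (lker0_lfunK (lker_inv g0)).
Qed.

Lemma pointwise_stab_conj g h H : G g -> pointwise_stab G H h ->
  pointwise_stab G (g @: H) (g \o h \o g^-1)%VF.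
Proof.
have [_ _ GM GV] := hG; move=> Gg [Gh /subvP hH].
have g0 := unitary_subgroup_lker0 Gg.
split; first exact: GM (GM _ _ Gg Gh) (GV _ Gg).
apply/subvP => _ /memv_imgP[x xH ->]; apply/fixedSpaceP.
by rewrite !comp_lfunE/= lker0_lfunK// (fixedSpaceP (hH _ xH)).
Qed.

Lemma pointwise_stab_conj_bij g H : G g ->
  set_bij (pointwise_stab G H) (pointwise_stab G (g @: H))
    (fun h => g \o h \o g^-1)%VF.
Proof.
have [_ _ _ GV] := hG; move=> Gg; have g0 := unitary_subgroup_lker0 Gg.
split=> [h hH|h h' _ _ /(congr1 (fun f => g^-1 \o f \o g)%VF)|h hH].
- exact: pointwise_stab_conj.
- by rewrite !comp_lfunA !lker0_compVf// !comp_lfun1l !lker0_compfVK.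
- exists (g^-1 \o h \o g)%VF; last first.
    by rewrite !comp_lfunA lker0_compfV// comp_lfun1l lker0_compfK.
  by have := pointwise_stab_conj (GV _ Gg) hH; rewrite limgK// lfun_invK.
Qed.

Lemma reflection_hyperplanes_limg g H : G g ->
  reflection_hyperplanes G H -> reflection_hyperplanes G (g @: H)%VS.
Proof.
move=> Gg [hH stabH]; have g0 := unitary_subgroup_lker0 Gg.
split.
  by rewrite /hyperplane limg_dim_eq// (eqP g0) capv0.
move=> E; apply: stabH; apply/seteqP; split=> [h hH'|_ ->]; last first.
  exact: pointwise_stab1.
(* If the stabilizer of the image were trivial, conjugation by [g], being injective, would force [h]
   to be the identity. *)
have [_ inj _] := pointwise_stab_conj_bij H Gg.
apply: inj; rewrite ?inE//; first exact: pointwise_stab1.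
have := pointwise_stab_conj Gg hH'; rewrite E => ->.
by rewrite comp_lfun1r lker0_compfV.
Qed.

Lemma reflection_hyperplanes_limg_bij g : G g ->
  set_bij (reflection_hyperplanes G) (reflection_hyperplanes G)
    (fun H => g @: H)%VS.
Proof.
move=> Gg; have g0 := unitary_subgroup_lker0 Gg.
split=> [H hH|H H' _ _ /(congr1 (fun H => g^-1 @: H)%VS)|H hH].
- exact: reflection_hyperplanes_limg.
- by rewrite !limgK.
- exists (g^-1 @: H)%VS; last by rewrite limgVK.
  by apply: reflection_hyperplanes_limg => //; have [_ _ _] := hG; exact.
Qed.

Lemma hyp_order_limg g H : G g -> hyp_order G (g @: H) = hyp_order G H.
Proof.
(* The cardinality becomes a sum of ones, which conjugation by [g] reindexes. *)
move=> Gg; rewrite /hyp_order !finmap.card_fset_sum1.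
rewrite -!fsbig_finite; try exact: pointwise_stab_finite.
by rewrite (reindex_fsbig _ _ _ _ (pointwise_stab_conj_bij H Gg)).
Qed.

Lemma hyp_orbit_limg g H : G g -> hyp_orbit G (g @: H) = hyp_orbit G H.
Proof.
have [_ _ GM GV] := hG; move=> Gg; have g0 := unitary_subgroup_lker0 Gg.
apply/seteqP; split=> [_ [h Gh <-]|_ [h Gh <-]].
  by exists (h \o g)%VF; [exact: GM|rewrite limg_comp].
exists (h \o g^-1)%VF; first by apply: GM => //; exact: GV.
by rewrite limg_comp limgK.
Qed.

End Stabilizer.
End UnitaryGroups.

(** * The operators a_H(k) and their division by alpha_H *)

Section DunklOperators.
Context {C : numClosedFieldType} {V : vectType C}.
Context (dot : {dot V for Num.conj}) (G : set 'End(V)).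
Context (hG : unitary_subgroup dot G) (finG : finite_set G).
Context (alpha : {vspace V} -> 'Hom(V, C^o)).
Context (halpha : forall H, reflection_hyperplanes G H -> lker (alpha H) = H).
Context (k : set {vspace V} -> nat -> C).
Implicit Types (f p q : V -> C) (l : 'Hom(V, C^o)) (x u v xi eta : V).
Implicit Types (g h : 'End(V)) (H : {vspace V}).

Local Notation elems A := (finmap.enum_fset (fset_set A)).

Local Notation stab := (pointwise_stab G).

Local Notation RH := (reflection_hyperplanes G).

Local Notation T := (dunkl G alpha k).

Let G_lker0 g (Gg : G g) : lker g == 0%VS := unitary_subgroup_lker0 hG Gg.

Let stab_finite H : finite_set (stab H) := pointwise_stab_finite finG H.

Let RH_finite : finite_set RH := reflection_hyperplanes_finite hG finG.

Lemma elemsP (I : choiceType) (A : set I) i : finite_set A -> i \in elems A -> A i.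
Proof. by move=> finA; rewrite in_fset_set// inE. Qed.

Lemma alpha_neq0 H : RH H -> alpha H != 0.
Proof.
move=> RH_H; apply/eqP => aH0; have [hH _] := RH_H.
have HE : H = {:V}%VS.
  apply/eqP; rewrite eqEsubv subvf/=; apply/subvP => x _.
  by rewrite -(halpha RH_H) aH0 memv_ker zero_lfunE.
by have /eqP := hH; rewrite HE -[X in _ == X]addn0 -addn1 eqn_add2l.
Qed.

(** A normalized vector transverse to [H]; the default [0] is never taken when [H] is a reflection
    hyperplane. *)
Definition dunkl_vector H : V := xget 0 [set u | alpha H u = 1].

Lemma alpha_dunkl_vector H : RH H -> alpha H (dunkl_vector H) = 1.
Proof.
move=> /alpha_neq0/lfun_preim1[u au]; rewrite /dunkl_vector.
by case: xgetP => [//|/(_ u)]; case.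
Qed.

(** The coefficient of [g] in a_H(k), after the factor e_H has cancelled the 1/e_H of the
    idempotents. *)
Definition dunkl_coef H g : C :=
  \sum_(1 <= i < hyp_order G H) k (hyp_orbit G H) i * lfun_det g ^+ i.

Lemma hyp_order_gt0 H : (0 < hyp_order G H)%N.
Proof.
rewrite /hyp_order finmap.cardfs_gt0; apply/finmap.fset0Pn; exists \1%VF.
by rewrite in_fset_set// inE; exact: pointwise_stab1 hG _.
Qed.

Lemma aHE H p x :
  aH G k H p x = \sum_(g <- elems (stab H)) dunkl_coef H g * gact g p x.
Proof.
rewrite /aH /epsH.
under eq_bigr do rewrite fsbig_finite// mulrACA mulfV ?pnatr_eq0 -?lt0n
  ?hyp_order_gt0// mul1r big_distrr/=.
rewrite exchange_big/=; apply: eq_bigr => g _; rewrite big_distrl/=.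
by apply: eq_bigr => i _; rewrite mulrA.
Qed.

(** For each index [i] the inner sum runs over the values of a nontrivial character. Hence a_H(k)
    kills constants, and its image vanishes on [H]. *)
Lemma dunkl_coef_sum0 H : RH H -> \sum_(g <- elems (stab H)) dunkl_coef H g = 0.
Proof.
move=> RH_H; rewrite exchange_big/= big_nat; apply: big1 => i ie.
rewrite -big_distrr/= -fsbig_finite//.
have aH0 := alpha_neq0 RH_H.
by rewrite (pointwise_stab_det_sum hG finG (halpha RH_H) aH0 ie) mulr0.
Qed.

Lemma polyfun_gact g p : polyfun p -> polyfun (gact g p).
Proof. exact: polyfun_comp. Qed.

Lemma aHD H f p x :
  aH G k H (fun y => f y + p y) x = aH G k H f x + aH G k H p x.
Proof.
by rewrite !aHE -big_split/=; apply: eq_bigr => g _; rewrite -mulrDr.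
Qed.

Lemma aHZ H (c : C) p x : aH G k H (fun y => c * p y) x = c * aH G k H p x.
Proof.
by rewrite !aHE big_distrr/=; apply: eq_bigr => g _; rewrite mulrCA.
Qed.

Lemma aH_cst H (c : C) x : RH H -> aH G k H (fun=> c) x = 0.
Proof. by move=> RH_H; rewrite aHE -big_distrl/= dunkl_coef_sum0// mul0r. Qed.

Lemma polyfun_aH H p : polyfun p -> polyfun (aH G k H p).
Proof.
move=> pp; apply: eq_polyfun (aHE H p) _; apply: polyfun_sum => g _.
by apply: polyfunM; [exact: polyfun_cst|exact: polyfun_gact].
Qed.

(** At a point of [H] all the [gact g p] take the value [p x], so the coefficients add up to zero.
    This is what makes a_H(k)p divisible by alpha_H. *)
Lemma aH_vanish H p x : RH H -> alpha H x = 0 -> aH G k H p x = 0.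
Proof.
move=> RH_H ax; rewrite aHE big_seq.
under eq_bigr => g /(elemsP (stab_finite H)) gH.
  have [_ /subvP gV] := pointwise_stabV hG gH.
  rewrite /gact (fixedSpaceP (gV x _)); last first.
    by rewrite -(halpha RH_H) memv_ker ax.
  over.
by rewrite -big_seq -big_distrl/= dunkl_coef_sum0// mul0r.
Qed.

Definition aH_quo H p : V -> C := polyquo (aH G k H p) (alpha H).

Lemma aH_quoP H p : RH H -> polyfun p ->
  polyfun (aH_quo H p) /\ forall x, aH G k H p x = alpha H x * aH_quo H p x.
Proof.
move=> RH_H pp; apply: polyquoP; [exact: polyfun_aH|exact: alpha_neq0|].
by move=> x; exact: aH_vanish.
Qed.

Lemma aH_quo_eq H p q : RH H -> polyfun q ->
  (forall x, aH G k H p x = alpha H x * q x) -> aH_quo H p = q.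
Proof. by move=> RH_H pq; apply: polyquo_eq => //; exact: alpha_neq0. Qed.

Lemma aH_quoD H f p : RH H -> polyfun f -> polyfun p ->
  aH_quo H (fun x => f x + p x) = fun x => aH_quo H f x + aH_quo H p x.
Proof.
move=> RH_H pf pp; have [pqf qf] := aH_quoP RH_H pf.
have [pqp qp] := aH_quoP RH_H pp.
by apply: aH_quo_eq => // [|x]; [exact: polyfunD|rewrite aHD qf qp mulrDr].
Qed.

Lemma aH_quoZ H (c : C) p : RH H -> polyfun p ->
  aH_quo H (fun x => c * p x) = fun x => c * aH_quo H p x.
Proof.
move=> RH_H pp; have [pqp qp] := aH_quoP RH_H pp.
apply: aH_quo_eq => // [|x]; last by rewrite aHZ qp mulrCA.
by apply: polyfunM => //; exact: polyfun_cst.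
Qed.

(** * Linearity of the Dunkl operators in the polynomial and in the direction *)

Lemma dunklE xi p x :
  T xi p x = dirderive xi p x + \sum_(H <- elems RH) alpha H xi * aH_quo H p x.
Proof. by rewrite /dunkl fsbig_finite. Qed.

Lemma eq_sum_RH (E F : {vspace V} -> C) : (forall H, RH H -> E H = F H) ->
  \sum_(H <- elems RH) E H = \sum_(H <- elems RH) F H.
Proof.
move=> EF; rewrite !(big_seq _ _ (elems RH)); apply: eq_bigr => H.
by move=> /(elemsP RH_finite); exact: EF.
Qed.

Lemma polyfun_dunkl xi p : polyfun p -> polyfun (T xi p).
Proof.
move=> pp; apply: eq_polyfun (dunklE xi p) _.
apply: polyfunD; first exact: polyfun_dirderive.
under [X in polyfun X]funext do rewrite big_seq.
apply: polyfun_sum => H /(elemsP RH_finite) RH_H.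
by apply: polyfunM; [exact: polyfun_cst|case: (aH_quoP RH_H pp)].
Qed.

Lemma dunklD xi f p : polyfun f -> polyfun p ->
  T xi (fun x => f x + p x) = fun x => T xi f x + T xi p x.
Proof.
move=> pf pp; apply/funext => x; rewrite !dunklE dirderiveD// addrACA -big_split/=.
by congr +%R; apply: eq_sum_RH => H RH_H; rewrite aH_quoD// mulrDr.
Qed.

Lemma dunklZ xi (c : C) p : polyfun p ->
  T xi (fun x => c * p x) = fun x => c * T xi p x.
Proof.
move=> pp; apply/funext => x; rewrite !dunklE dirderiveZ// mulrDr big_distrr/=.
by congr +%R; apply: eq_sum_RH => H RH_H; rewrite aH_quoZ// mulrCA.
Qed.

Lemma dunkl_cst xi (c : C) : T xi (fun=> c) = fun=> 0.
Proof.
apply/funext => x; rewrite dunklE dirderive_cst add0r.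
transitivity (\sum_(H <- elems RH) (0 : C)); last by rewrite big1.
apply: eq_sum_RH => H RH_H; rewrite (@aH_quo_eq _ _ (fun=> 0))// ?mulr0//.
  exact: polyfun_cst.
by move=> y; rewrite aH_cst// mulr0.
Qed.

Lemma dunkl_sum xi (I : eqType) (r : seq I) (c : I -> C) (F : I -> V -> C) :
  (forall i, i \in r -> polyfun (F i)) ->
  T xi (fun x => \sum_(i <- r) c i * F i x) =
  fun x => \sum_(i <- r) c i * T xi (F i) x.
Proof.
elim: r => [|i r IHr] polyF; apply/funext => x; rewrite ?big_nil ?big_cons.
  by under [X in T xi X]funext do rewrite big_nil; rewrite dunkl_cst.
under [X in T xi X]funext do rewrite big_cons.
have polyFi : polyfun (F i) by apply: polyF; rewrite mem_head.
have polyFr j : j \in r -> polyfun (F j).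
  by move=> jr; apply: polyF; rewrite inE jr orbT.
rewrite dunklD.
- by rewrite dunklZ// IHr.
- by apply: polyfunM => //; exact: polyfun_cst.
- under [X in polyfun X]funext do rewrite big_seq.
  apply: polyfun_sum => j jr.
  by apply: polyfunM; [exact: polyfun_cst|exact: polyFr].
Qed.

Lemma dunkl_dirP (c : C) xi eta p x : polyfun p ->
  T (xi + c *: eta) p x = T xi p x + c * T eta p x.
Proof.
move=> pp; rewrite !dunklE dirderive_dirP// mulrDr addrACA.
rewrite big_distrr/= -big_split/=.
congr +%R; apply: eq_sum_RH => H RH_H; rewrite linearD linearZ/= mulrDl.
by rewrite -[c *: _]/(c * _) mulrA.
Qed.

(** * Equivariance of the Dunkl operators *)

Lemma dunkl_coef_conj g h H : G g ->
  dunkl_coef (g @: H) (g \o h \o g^-1) = dunkl_coef H h.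
Proof.
(* Equivariance rests on the parameters being indexed by orbits: [H] and its image share the same
   [k]. *)
move=> Gg; rewrite /dunkl_coef (hyp_order_limg hG finG)// (hyp_orbit_limg hG)//.
by under eq_bigr do rewrite (lfun_det_conj _ (G_lker0 Gg)).
Qed.

Lemma aH_gact g H p x : G g ->
  aH G k (g @: H) (gact g p) x = aH G k H p ((g^-1)%VF x).
Proof.
move=> Gg; rewrite !aHE -!fsbig_finite//.
rewrite (reindex_fsbig _ _ _ _ (pointwise_stab_conj_bij hG H Gg)).
apply: eq_fsbigr => h; rewrite inE => hH; rewrite dunkl_coef_conj//.
congr (_ * p _).
have [Gh _] := hH; have g0 := G_lker0 Gg; have h0 := G_lker0 Gh.
have [Gc _] := pointwise_stab_conj hG Gg hH.
(* The two arguments of [p] are compared after applying [g] and then the conjugate of [h], so that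
   the inverse of the conjugate need not be expanded. *)
apply: (can_inj (lker0_lfunK g0)); rewrite lker0_lfunVK//.
have c0 := G_lker0 Gc.
apply: (can_inj (lker0_lfunK c0)); rewrite (lker0_lfunVK c0).
by rewrite !comp_lfunE/= lker0_lfunK// !lker0_lfunVK.
Qed.

(** The forms are chosen separately for each hyperplane, so they are equivariant only up to a
    scalar: both sides vanish on [H]. *)
Lemma alpha_limg g H : G g -> RH H ->
  exists2 c : C, c != 0 & forall y, alpha (g @: H) (g y) = c * alpha H y.
Proof.
move=> Gg RH_H; pose u := dunkl_vector H.
have RH_gH := reflection_hyperplanes_limg hG Gg RH_H.
have gE y : alpha (g @: H) (g y) = alpha (g @: H) (g u) * alpha H y.
  have : g (y - (alpha H y : C) *: u) \in lker (alpha (g @: H)%VS).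
    rewrite halpha//; apply: memv_img.
    have := memv_ker (alpha H) (y - (alpha H y : C) *: u).
    rewrite halpha// => ->.
    rewrite linearB linearZ/= alpha_dunkl_vector//.
    by rewrite [_ *: _]mulr1 subrr.
  rewrite memv_ker linearB linearZ/= => /eqP.
  rewrite linearB linearZ/= => /eqP; rewrite subr_eq0 => /eqP ->.
  by rewrite [LHS]mulrC.
exists (alpha (g @: H) (g u)) => //.
apply: contra (alpha_neq0 RH_gH) => /eqP gu0; apply/eqP/lfunP => y.
by rewrite -(lker0_lfunVK (G_lker0 Gg) y) gE gu0 mul0r zero_lfunE.
Qed.

(** The scalar from [alpha_limg] multiplies the value of the form and divides the quotient, so it
    cancels in the product. *)
Lemma aH_quo_gact g H p xi x : G g -> RH H -> polyfun p ->
  alpha (g @: H) (g xi) * aH_quo (g @: H) (gact g p) x =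
  alpha H xi * aH_quo H p ((g^-1)%VF x).
Proof.
move=> Gg RH_H pp; have [c c0 gE] := alpha_limg Gg RH_H.
have RH_gH := reflection_hyperplanes_limg hG Gg RH_H.
have [pqp qp] := aH_quoP RH_H pp.
rewrite (@aH_quo_eq _ _ (fun y => c^-1 * aH_quo H p ((g^-1)%VF y)))//.
- by rewrite gE mulrCA !mulrA mulVf// mul1r.
- by apply: polyfunM; [exact: polyfun_cst|exact: polyfun_comp].
move=> y; rewrite aH_gact// qp.
rewrite -[in RHS](lker0_lfunVK (G_lker0 Gg) y) gE (lker0_lfunVK (G_lker0 Gg)).
by rewrite mulrCA !mulrA mulVf// mul1r.
Qed.

Lemma gact_dunkl g xi p : G g -> polyfun p ->
  gact g (T xi p) = T (g xi) (gact g p).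
Proof.
move=> Gg pp; apply/funext => x; rewrite /gact !dunklE; congr (_ + _).
  rewrite /dirderive.
  suff -> : (fun t : C^o => p ((g^-1)%VF x + t *: xi) : C^o) =
    (fun t => p ((g^-1)%VF (x + t *: g xi))) by [].
  by apply/funext => t; rewrite linearD linearZ/= (lker0_lfunK (G_lker0 Gg)).
rewrite -!fsbig_finite//.
rewrite [RHS](reindex_fsbig _ _ _ _ (reflection_hyperplanes_limg_bij hG Gg)).
by apply: eq_fsbigr => H; rewrite inE => RH_H; rewrite aH_quo_gact.
Qed.

(** * Commutators with multiplication by a linear form *)

Definition dunkl_residue l H p : V -> C := fun x =>
  \sum_(g <- elems (stab H))
    dunkl_coef H g *
      (l ((g^-1)%VF (dunkl_vector H)) - l (dunkl_vector H)) * gact g p x.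

Lemma polyfun_dunkl_residue l H p : polyfun p -> polyfun (dunkl_residue l H p).
Proof.
move=> pp; apply: polyfun_sum => g _.
by apply: polyfunM; [exact: polyfun_cst|exact: polyfun_gact].
Qed.

(** With [u] the vector [dunkl_vector H], [l (g^-1 y) - l y = alpha H y * (l (g^-1 u) - l u)], so
    alpha_H divides out explicitly. Thus [dunkl_residue l H] is the commutator of [aH_quo H] with
    [l], and it involves no quotient. *)
Lemma aH_quo_lfunM l H p x : RH H -> polyfun p ->
  aH_quo H (fun y => l y * p y) x = l x * aH_quo H p x + dunkl_residue l H p x.
Proof.
move=> RH_H pp; have [pqp qp] := aH_quoP RH_H pp.
rewrite (@aH_quo_eq _ _ (fun y =>
    l y * aH_quo H p y + dunkl_residue l H p y))//.
  apply: polyfunD; last exact: polyfun_dunkl_residue.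
  by apply: polyfunM => //; exact: polyfun_lfun.
move=> y.
rewrite mulrDr mulrCA -qp !aHE /dunkl_residue !big_distrr/= -big_split/=.
rewrite !(big_seq _ _ (elems (stab H))); apply: eq_bigr => g.
move=> /(elemsP (stab_finite H)) /(pointwise_stabV hG) gH.
rewrite /gact {1}(pointwise_stabE (halpha RH_H) (alpha_dunkl_vector RH_H) gH y).
rewrite linearD linearZ linearB/= -[_ *: _]/(_ * _); ring.
Qed.

Lemma dunkl_lfunM xi l p x : polyfun p ->
  T xi (fun y => l y * p y) x = l x * T xi p x +
    (l xi * p x + \sum_(H <- elems RH) alpha H xi * dunkl_residue l H p x).
Proof.
move=> pp; rewrite !dunklE dirderiveM//; last exact: polyfun_lfun.
rewrite dirderive_lfun.
have -> : \sum_(H <- elems RH) alpha H xi * aH_quo H (fun y => l y * p y) x =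
    l x * (\sum_(H <- elems RH) alpha H xi * aH_quo H p x) +
    \sum_(H <- elems RH) alpha H xi * dunkl_residue l H p x.
  rewrite big_distrr/= -big_split/=; apply: eq_sum_RH => H RH_H.
  by rewrite aH_quo_lfunM// mulrDr; congr (_ + _); rewrite mulrCA.
ring.
Qed.

(* [g eta = eta + alpha_H(eta) (g u - u)] for g in the stabilizer, so
   equivariance makes this commutator proportional to alpha_H(eta). *)
Lemma dunkl_residue_comm l H p x : RH H -> polyfun p ->
  exists K : C, forall eta, dunkl_residue l H (T eta p) x =
    T eta (dunkl_residue l H p) x + alpha H eta * K.
Proof.
move=> RH_H pp; pose u := dunkl_vector H.
pose d g := dunkl_coef H g * (l ((g^-1)%VF u) - l u).
exists (\sum_(g <- elems (stab H)) d g * T (g u - u) (gact g p) x) => eta.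
rewrite /dunkl_residue dunkl_sum; last by move=> g _; exact: polyfun_gact.
rewrite big_distrr/= -big_split/= !(big_seq _ _ (elems (stab H))).
apply: eq_bigr => g /(elemsP (stab_finite H)) gH; have [Gg _] := gH.
rewrite gact_dunkl//.
rewrite (pointwise_stabE (halpha RH_H) (alpha_dunkl_vector RH_H) gH eta).
rewrite dunkl_dirP; last exact: polyfun_gact.
rewrite -/u -/(d g); ring.
Qed.

(** Everything except [l x * T xi (T eta p) x] is symmetric in [xi] and [eta], because [K] depends
    on neither; exchanging the two and subtracting shows that the commutator commutes with [l]. *)
Lemma dunkl_lfunM2 l p x : polyfun p ->
  exists K : {vspace V} -> C, forall xi eta,
  T xi (T eta (fun y => l y * p y)) x = l x * T xi (T eta p) x +
    (l xi * T eta p x + l eta * T xi p x) +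
    \sum_(H <- elems RH) (alpha H xi * T eta (dunkl_residue l H p) x +
      alpha H eta * T xi (dunkl_residue l H p) x + alpha H xi * alpha H eta * K H).
Proof.
move=> pp.
(* One constant per hyperplane is fixed before the directions are introduced; it is 0 off the
   reflection hyperplanes. *)
have /choice[K KE] : forall H, exists K : C, RH H -> forall eta,
    dunkl_residue l H (T eta p) x =
    T eta (dunkl_residue l H p) x + alpha H eta * K.
  move=> H; have [RH_H|] := pselect (RH H); last by exists 0.
  by have [K KE] := dunkl_residue_comm l x RH_H pp; exists K.
exists K => xi eta.
have pT eta' : polyfun (T eta' p) by exact: polyfun_dunkl.
have pR H : polyfun (dunkl_residue l H p) by exact: polyfun_dunkl_residue.
rewrite (funext (fun y => dunkl_lfunM eta l y pp)).
have pl q : polyfun q -> polyfun (fun y => l y * q y).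
  by apply: polyfunM; exact: polyfun_lfun.
have pZ (c : C) q : polyfun q -> polyfun (fun y => c * q y).
  by apply: polyfunM; exact: polyfun_cst.
have pS : polyfun (fun y =>
    \sum_(H <- elems RH) alpha H eta * dunkl_residue l H p y).
  by apply: polyfun_sum => H _; exact: pZ.
rewrite (dunklD xi (pl _ (pT eta)) (polyfunD (pZ (l eta) _ pp) pS)).
rewrite dunkl_lfunM// (dunklD xi (pZ (l eta) _ pp) pS) (dunklZ xi (l eta) pp).
rewrite dunkl_sum//.
have -> : \sum_(H <- elems RH) alpha H xi * dunkl_residue l H (T eta p) x =
   \sum_(H <- elems RH) (alpha H xi * T eta (dunkl_residue l H p) x +
     alpha H xi * alpha H eta * K H).
  by apply: eq_sum_RH => H RH_H; rewrite KE// mulrDr mulrA.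
rewrite !big_split/=; ring.
Qed.

(** * Vanishing of the commutator *)

Lemma dunkl_comm xi eta p : polyfun p -> T xi (T eta p) = T eta (T xi p).
Proof.
pose D f x := T xi (T eta f) x - T eta (T xi f) x.
have DD f q x : polyfun f -> polyfun q ->
    D (fun y => f y + q y) x = D f x + D q x.
  move=> pf pq; rewrite /D (dunklD eta pf pq) (dunklD xi pf pq).
  rewrite (dunklD xi (polyfun_dunkl eta pf) (polyfun_dunkl eta pq)).
  rewrite (dunklD eta (polyfun_dunkl xi pf) (polyfun_dunkl xi pq)); ring.
have DZ (c : C) f x : polyfun f -> D (fun y => c * f y) x = c * D f x.
  move=> pf; rewrite /D (dunklZ eta c pf) (dunklZ xi c pf).
  rewrite (dunklZ xi c (polyfun_dunkl eta pf)).
  by rewrite (dunklZ eta c (polyfun_dunkl xi pf)) mulrBr.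
have Dl l f x : polyfun f -> D (fun y => l y * f y) x = l x * D f x.
  move=> pf; have [K KE] := dunkl_lfunM2 l x pf.
  rewrite /D (KE xi eta) (KE eta xi).
  have -> : \sum_(H <- elems RH) (alpha H eta * T xi (dunkl_residue l H f) x +
      alpha H xi * T eta (dunkl_residue l H f) x + alpha H eta * alpha H xi * K H) =
    \sum_(H <- elems RH) (alpha H xi * T eta (dunkl_residue l H f) x +
      alpha H eta * T xi (dunkl_residue l H f) x + alpha H xi * alpha H eta * K H).
    by apply: eq_bigr => H _; ring.
  ring.
have D1 x : D (fun=> 1) x = 0.
  rewrite /D (dunkl_cst xi 1) (dunkl_cst eta 1).
  by rewrite (dunkl_cst xi 0) (dunkl_cst eta 0) subrr.
move=> pp; apply/funext => x; apply/eqP; rewrite -subr_eq0; apply/eqP.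
exact: (polyfun_mul_commuting_eq0 DD DZ Dl D1 pp x).
Qed.

End DunklOperators.

Theorem theorem2p12 (R : realType) (V : vectType R[i])
    (dot : {dot V for Num.conj}) (G : set 'End(V))
    (hG : finite_complex_reflection_group dot G)
    (alpha : {vspace V} -> 'Hom(V, R[i]^o))
    (halpha : forall H, reflection_hyperplanes G H -> lker (alpha H) = H)
    (k : set {vspace V} -> nat -> R[i]) (xi eta : V) (p : V -> R[i])
    (hp : polyfun p) :
  dunkl G alpha k xi (dunkl G alpha k eta p) =
  dunkl G alpha k eta (dunkl G alpha k xi p).
Proof.
by have [uG finG _] := hG; exact: (dunkl_comm uG finG halpha k xi eta hp).
Qed.
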